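(* Let $w_1,w_2,w_3$ be any positive integers. Then for every integer $n\ge 0$ and every $y_1\in\mathbb{Z}_p$, the following three expressions are equal (all sums run over nonnegative integers $k,l,m$ with $k+l+m=n$): \begin{align*} &\sum_{k+l+m=n}\binom{n}{k,l,m}B_{k,\chi,\xi^{w_2w_3}}(w_1y_1)\,S_l(dw_2-1;\chi,\xi^{w_1w_3})\,S_m(dw_3-1;\chi,\xi^{w_1w_2})\,w_1^{l+m}w_2^{k+m-1}w_3^{k+l-1}\\ =&\sum_{k+l+m=n}\binom{n}{k,l,m}B_{k,\chi,\xi^{w_1w_3}}(w_2y_1)\,S_l(dw_3-1;\chi,\xi^{w_1w_2})\,S_m(dw_1-1;\chi,\xi^{w_2w_3})\,w_2^{l+m}w_3^{k+m-1}w_1^{k+l-1}\\ =&\sum_{k+l+m=n}\binom{n}{k,l,m}B_{k,\chi,\xi^{w_1w_2}}(w_3y_1)\,S_l(dw_1-1;\chi,\xi^{w_2w_3})\,S_m(dw_2-1;\chi,\xi^{w_1w_3})\,w_3^{l+m}w_1^{k+m-1}w_2^{k+l-1}. \end{align*}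
   Context: Let $p$ be a fixed prime, $\mathbb{Z}_p$ the ring of $p$-adic integers, and $\mathbb{C}_p$ the completion of an algebraic closure of $\mathbb{Q}_p$. Let $\Gamma_r=\{\xi\in\mathbb{C}_p : \xi^{p^s}=1 \text{ for some } s\in\mathbb{Z}_{>0}\}$ (ramified roots of unity) and fix any $\xi\in\Gamma_r$. Let $d$ be a fixed positive integer and $\chi$ a (primitive) Dirichlet character of conductor $d$, viewed as a function $\mathbb{Z}\to\mathbb{C}_p$ via a fixed embedding $\overline{\mathbb{Q}}\to\mathbb{C}_p$ (periodic mod $d$, zero on integers not coprime to $d$; if $d=1$, $\chi\equiv 1$). For $\eta\in\Gamma_r$, the generalized twisted Bernoulli polynomials $B_{n,\chi,\eta}(x)$ attached to $\chi$ and $\eta$ are the polynomials in $x$ with coefficients in $\mathbb{C}_p$ defined by the power series expansion in $t$ $$\frac{te^{xt}}{\eta^{d}e^{dt}-1}\sum_{a=0}^{d-1}\chi(a)\eta^{a}e^{at}=\sum_{n=0}^{\infty}B_{n,\chi,\eta}(x)\frac{t^n}{n!}.$$ For integers $k,n\ge 0$ and $\eta\in\Gamma_r$, the $k$th generalized twisted power sum is $S_k(n;\chi,\eta)=\sum_{a=0}^{n}\chi(a)\eta^a a^k$, with the convention $0^0=1$. Also $\binom{n}{k,l,m}=\frac{n!}{k!\,l!\,m!}$. *)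

(* Defs.v *)
From mathcomp Require Import all_boot all_order all_algebra all_field.
From mathcomp Require Import boolp classical_sets reals.

Set Implicit Arguments.
Unset Strict Implicit.
Unset Printing Implicit Defensive.

Import Order.TTheory GRing.Theory Num.Theory.

Local Open Scope ring_scope.

(** C_p is determined up to isometric isomorphism, so it is axiomatized rather
    than constructed: [is_padic_complex abs p] says that the field [K] with the
    absolute value [abs] is the completion of an algebraic closure of Q_p.
    Q_p, its algebraic closure and Z_p are taken inside [K]. *)

Definition padic_abs (R : realType) (p : nat) (q : rat) : R :=
  if q == 0 then 0
  else (p%:R : R) ^ ((logn p `|denq q|)%:Z - (logn p `|numq q|)%:Z).

Section ValuedField.

Variables (R : realType) (K : fieldType) (abs : K -> R).

Definition abs_dense (S T : K -> Prop) : Prop :=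
  forall x, T x -> forall e : R, 0 < e -> exists2 y, S y & abs (x - y) < e.

Definition abs_complete : Prop :=
  forall u : nat -> K,
    (forall e : R, 0 < e -> exists N : nat, forall i j : nat,
       (N <= i)%N -> (N <= j)%N -> abs (u i - u j) < e) ->
    exists l : K, forall e : R, 0 < e -> exists N : nat, forall i : nat,
      (N <= i)%N -> abs (u i - l) < e.

(* Topological closure of the prime field.  When [K] is complete and [abs]
   extends the p-adic absolute value, this is the completion of Q. *)
Definition in_Qp (x : K) : Prop :=
  forall e : R, 0 < e -> exists q : rat, abs (x - ratr q) < e.

Definition in_Zp (x : K) : Prop := in_Qp x /\ abs x <= 1.

Definition in_Qpbar (x : K) : Prop :=
  exists q : {poly K}, [/\ q != 0, forall i : nat, in_Qp q`_i & root q x].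

Record is_padic_complex (p : nat) : Prop := IsPadicComplex {
  padic_complex_abs_ge0 : forall x, 0 <= abs x;
  padic_complex_abs_eq0 : forall x, abs x = 0 -> x = 0;
  padic_complex_absM : forall x y, abs (x * y) = abs x * abs y;
  padic_complex_absD : forall x y, abs (x + y) <= Num.max (abs x) (abs y);
  padic_complex_abs_rat : forall q : rat, abs (ratr q) = padic_abs R p q;
  padic_complex_Qpbar_closed : forall q : {poly K},
    (forall i : nat, in_Qpbar q`_i) -> (1 < size q)%N ->
    exists2 x, in_Qpbar x & root q x;
  padic_complex_Qpbar_dense : abs_dense in_Qpbar (fun=> True);
  padic_complex_complete : abs_complete }.

End ValuedField.

Definition ramified_root (K : fieldType) (p : nat) (xi : K) : Prop :=
  exists2 s : nat, (0 < s)%N & xi ^+ (p ^ s) = 1.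

Record is_dirichlet (d : nat) (chi : int -> algC) : Prop := IsDirichlet {
  dirichlet_periodic : forall a, chi (a + d%:Z) = chi a;
  dirichletM : forall a b, chi (a * b) = chi a * chi b;
  dirichlet_neq0 : forall a, (chi a != 0) = coprimez a d }.

Definition induced_from (d f : nat) (chi : int -> algC) : Prop :=
  exists2 chi' : int -> algC,
    is_dirichlet f chi' & forall a, coprimez a d -> chi a = chi' a.

Definition is_primitive_dirichlet (d : nat) (chi : int -> algC) : Prop :=
  is_dirichlet d chi /\
  forall f : nat, (0 < f)%N -> (f %| d)%N -> induced_from d f chi -> f = d.

(** A formal power series in t over [A] is the sequence of its coefficients. *)

Section Series.

Variables (K : fieldType) (A : comAlgType K).

Definition series_mul (F G : nat -> A) : nat -> A :=
  fun n => \sum_(i < n.+1) F i * G (n - i)%N.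

Definition series_t : nat -> A := fun n => (n == 1)%:R.

Definition series_exp (c : A) : nat -> A := fun n => (n`!%:R : K)^-1 *: c ^+ n.

(* The series H such that G H = F, when there is one; it is unique when [A] is
   an integral domain and G is nonzero.  Here G need not be invertible. *)
Definition series_div (F G : nat -> A) : nat -> A :=
  xget (fun=> 0) [set H | series_mul G H = F]%classic.

End Series.

Section Bernoulli.

Variables (K : fieldType) (d : nat) (chi : int -> K).

(* t e^(x t) sum_(a < d) chi(a) eta^a e^(a t) as a series in t over K[x], the
   variable x being ['X]. *)
Definition bernoulli_num (eta : K) : nat -> {poly K} :=
  series_mul (series_mul (@series_t K {poly K}) (series_exp 'X))
    (fun n => \sum_(a < d)
       (chi a%:Z * eta ^+ a) *: series_exp (a%:R : {poly K}) n).

(* eta^d e^(d t) - 1 *)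
Definition bernoulli_den (eta : K) : nat -> {poly K} :=
  fun n => eta ^+ d *: series_exp (d%:R : {poly K}) n - (n == 0)%:R.

Definition bernoulli (n : nat) (eta : K) : {poly K} :=
  (n`!%:R : K) *: series_div (bernoulli_num eta) (bernoulli_den eta) n.

Definition power_sum (k n : nat) (eta : K) : K :=
  \sum_(a < n.+1) chi a%:Z * eta ^+ a * a%:R ^+ k.

End Bernoulli.

Definition trinomial (K : fieldType) (n k l m : nat) : K :=
  n`!%:R / (k`! * l`! * m`!)%:R.

Section BernoulliSpec.

Variable K : fieldType.

Fixpoint quotient_seq (c : nat -> K) (F : nat -> {poly K}) (n : nat) :
    seq {poly K} :=
  if n is n'.+1 then
    let s := quotient_seq c F n' in
    rcons s ((c 0)^-1 *:
      (F n' - \sum_(i < n') c (n' - i)%N *: s`_i))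
  else [::].

Lemma size_quotient_seq c F n : size (quotient_seq c F n) = n.
Proof. by elim: n => //= n IH; rewrite size_rcons IH. Qed.

Lemma nth_quotient_seq c F n i : (i < n)%N ->
  (quotient_seq c F n)`_i = (quotient_seq c F i.+1)`_i.
Proof.
elim: n => // n IH; rewrite ltnS leq_eqVlt => /predU1P[->//|lt_in].
by rewrite [LHS]/= nth_rcons size_quotient_seq lt_in IH.
Qed.

Lemma series_div_exists (c : nat -> K) (F : nat -> {poly K}) (v : nat) :
  c v != 0 -> (forall i, (i < v)%N -> c i = 0) ->
  (forall i, (i < v)%N -> F i = 0) ->
  exists H, series_mul (fun n => (c n)%:P) H = F.
Proof.
move=> cv c0 F0.
pose c' n := c (n + v)%N; pose F' n := F (n + v)%N.
pose H n := (quotient_seq c' F' n.+1)`_n.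
have HE n : c' 0 *: H n = F' n - \sum_(i < n) c' (n - i)%N *: H i.
  rewrite /H /= nth_rcons size_quotient_seq ltnn eqxx scalerA divff // scale1r.
  congr (_ - _); apply: eq_bigr => i _; congr (_ *: _).
  by rewrite (nth_quotient_seq _ _ (ltn_ord i)).
exists H; apply/funext => n; rewrite /series_mul.
have [lt_nv|le_vn] := ltnP n v.
  rewrite F0 // big1 // => i _; rewrite c0 ?mul0r //.
  by rewrite (leq_ltn_trans _ lt_nv) // -ltnS.
rewrite -(subnK le_vn); set m := (n - v)%N; rewrite -[RHS]/(F' m).
rewrite -(big_mkord xpredT (fun i => (c i)%:P * H (m + v - i)%N)) -addSn addnC.
rewrite (big_cat_nat (n := v)) ?leq_addr //= [X in X + _]big_nat_cond big1 ?add0r; last first.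
  by move=> i /andP[/andP[_ lt_iv] _]; rewrite c0 ?mul0r.
rewrite -{1}[v]add0n big_addn addKn big_mkord.
transitivity (\sum_(i < m.+1) c' i *: H (m - i)%N).
  apply: eq_bigr => i _; rewrite mul_polyC; congr (_ *: H _).
  by rewrite [(m + v)%N]addnC [(i + v)%N]addnC subnDl.
rewrite big_ord_recl /= subn0 HE -addrA -[RHS]addr0; congr (_ + _).
apply/eqP; rewrite addrC subr_eq0; apply/eqP.
rewrite [RHS](reindex_inj rev_ord_inj) /=.
by apply: eq_bigr => i _; rewrite /bump /= add1n subKn.
Qed.

(* The division in the generating function is exact, also when eta ^+ d = 1, in
   which case the denominator has no constant term. *)
Lemma bernoulli_spec (d : nat) (chi : int -> K) (eta : K) :
  [pchar K] =i pred0 -> (0 < d)%N -> eta != 0 ->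
  series_mul (bernoulli_den d eta)
    (fun n => (n`!%:R : K)^-1 *: bernoulli d chi n eta)
  = bernoulli_num d chi eta.
Proof.
move=> /pcharf0P nat0 d_gt0 eta0.
pose c n := eta ^+ d * ((n`!%:R)^-1 * d%:R ^+ n) - (n == 0)%:R : K.
have denE : bernoulli_den d eta = fun n => (c n)%:P.
  apply/funext => n; rewrite /bernoulli_den /series_exp /c.
  rewrite polyCB !polyCM !polyC_exp !polyC_natr -!mul_polyC polyC_exp.
  by rewrite mulrA.
have num0 : bernoulli_num d chi eta 0 = 0.
  by rewrite /bernoulli_num /series_mul !big_ord1 /series_t !mul0r.
have [H HE] : exists H, series_mul (bernoulli_den d eta) H
    = bernoulli_num d chi eta.
  rewrite denE; have [c00|c0] := eqVneq (c 0) 0; last first.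
    exact: (@series_div_exists _ _ 0).
  apply: (@series_div_exists _ _ 1) => [|[]//|[]//].
  by rewrite /c subr0 !mulf_neq0 ?expf_neq0 ?invr_neq0 ?nat0 -?lt0n ?fact_gt0.
have divE := xgetI (P := [set H | series_mul (bernoulli_den d eta) H
  = bernoulli_num d chi eta]%classic) (fun=> 0) HE.
apply: etrans divE; congr series_mul.
apply/funext => n; rewrite /bernoulli scalerA mulVf ?scale1r //.
by rewrite nat0 -lt0n fact_gt0.
Qed.

End BernoulliSpec.

(* Main.v *)
From HB Require Import structures.
Require Import Defs.
From mathcomp Require Import all_boot all_order all_algebra all_field.
From mathcomp Require Import boolp functions reals ring.

Set Implicit Arguments.
Unset Strict Implicit.
Unset Printing Implicit Defensive.

Import Order.TTheory GRing.Theory Num.Theory.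

Local Open Scope ring_scope.

(** With u = xi e^t in the ring of formal power series, let
    D_v = u^(dv) - 1 and N_v = sum_(a < d) chi(a) u^(av).  The three Bernoulli
    series and three power sum series involved are b_i = P N_v / D_v and
    s_i = Q N_v / D_v for v = w2 w3, w1 w3, w1 w2, where P = t e^(w1 w2 w3 y t)
    and Q = u^(d w1 w2 w3) - 1 are symmetric in the w_i.  Each expression is, up
    to n!, the coefficient of t^n in P Q^2 prod_v N_v / D_v.  The D_v may have
    zero constant term, but they are nonzero in an integral domain, so it is
    enough to compare products after multiplying by them. *)

(* An alias, so that the product is convolution rather than the pointwise
   product of functions. *)
Definition powser (K : comNzRingType) : Type := nat -> K.
HB.instance Definition _ (K : comNzRingType) :=
  GRing.Zmodule.copy (powser K) (nat -> K).

(** * The ring of formal power series *)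

Section Powser.

Variable K : comNzRingType.
Implicit Types f g h : powser K.

Definition powser_mul f g : powser K :=
  fun n => \sum_(i < n.+1) f i * g (n - i)%N.

Definition powser_one : powser K := fun n => (n == 0)%:R.

Let trunc N f : {poly K} := \poly_(i < N) f i.

(** Coefficient [n] of a product involves only coefficients of index at most [n], so commutativity
    and associativity are inherited from polynomials by truncation. *)
Lemma powser_mul_trunc N f g n : (n < N)%N ->
  powser_mul f g n = (trunc N f * trunc N g)`_n.
Proof.
move=> lt_nN; rewrite coefM; apply: eq_bigr => i _; rewrite !coef_poly.
by rewrite !(leq_ltn_trans _ lt_nN) ?leq_subr // -ltnS.
Qed.

Lemma powser_mulC : commutative powser_mul.
Proof. by move=> f g; apply/funext => n; rewrite !(@powser_mul_trunc n.+1) // mulrC. Qed.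

Lemma powser_mulA : associative powser_mul.
Proof.
move=> f g h; apply/funext => n.
transitivity ((trunc n.+1 f * trunc n.+1 g * trunc n.+1 h)`_n).
  rewrite -mulrA coefM; apply: eq_bigr => i _.
  by rewrite coef_poly ltn_ord -powser_mul_trunc // ltnS leq_subr.
rewrite coefM; apply: eq_bigr => i _.
by rewrite coef_poly ltnS leq_subr -powser_mul_trunc.
Qed.

Lemma powser_mul1 : left_id powser_one powser_mul.
Proof.
move=> f; apply/funext => n; rewrite /powser_mul big_ord_recl mul1r subn0.
by rewrite big1 ?addr0 // => i _; rewrite mul0r.
Qed.

Lemma powser_mulDl : left_distributive powser_mul +%R.
Proof.
move=> f g h; apply/funext => n.
rewrite -[RHS]/(powser_mul f h n + powser_mul g h n) -big_split /=.
by apply: eq_bigr => i _; rewrite mulrDl.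
Qed.

Lemma powser_one_neq0 : powser_one != 0.
Proof. by apply/eqP => /(congr1 (@^~ 0%N)) /eqP; rewrite oner_eq0. Qed.

HB.instance Definition _ := GRing.Zmodule_isComNzRing.Build (powser K)
  powser_mulA powser_mulC powser_mul1 powser_mulDl powser_one_neq0.

Lemma powserBE f g n : (f - g) n = f n - g n. Proof. by []. Qed.
Lemma powserME f g n : (f * g) n = \sum_(i < n.+1) f i * g (n - i)%N.
Proof. by []. Qed.
Lemma powser1E n : (1 : powser K) n = (n == 0)%:R. Proof. by []. Qed.
Lemma powser_sumE (I : Type) (r : seq I) (P : pred I) (F : I -> powser K) n :
  (\sum_(i <- r | P i) F i) n = \sum_(i <- r | P i) F i n.
Proof. exact: (big_morph (fun f : powser K => f n)). Qed.

(** The ranges and the side condition are those of the sums in the theorem. The innermost sum has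
    one term if [k + l <= n] and none otherwise. *)
Lemma powserM3E f g h n : (f * g * h) n =
  \sum_(k < n.+1) \sum_(l < n.+1) \sum_(m < n.+1 | (k + l + m == n)%N)
    f k * g l * h m.
Proof.
rewrite -mulrA powserME; apply: eq_bigr => k _.
have le_kn : (k <= n)%N by rewrite -ltnS.
rewrite powserME big_distrr /=.
rewrite (big_ord_widen n.+1 (fun l => f k * (g l * h (n - k - l)%N))); last first.
  by rewrite ltnS leq_subr.
rewrite [LHS]big_mkcond; apply: eq_bigr => l _; rewrite ltnS; case: ifP => le_l.
  have le_kl : (k + l <= n)%N by rewrite -leq_subRL.
  have ltm : (n - (k + l) < n.+1)%N by rewrite ltnS leq_subr.
  rewrite (big_pred1 (Ordinal ltm)) /= ?subnDA ?mulrA // => m /=.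
  by rewrite -val_eqE /= -[RHS](eqn_add2l (k + l)) subnKC.
rewrite big1 // => m /eqP Em; move: le_l.
by rewrite leq_subRL // -[X in (_ <= X)%N]Em leq_addr.
Qed.

End Powser.

(** Let [f i] be the first nonzero coefficient of [f]. If [f * g = 0], coefficient [i + j] reduces
    to [f i * g j] once the earlier coefficients of [g] are known to vanish. *)
Lemma powser_lreg (K : fieldType) (f : powser K) n : f n != 0 -> GRing.lreg f.
Proof.
move=> fn g1 g2 /eqP; rewrite -subr_eq0 -mulrBr => /eqP fg0.
apply/eqP; rewrite -subr_eq0; apply/eqP; move: (g1 - g2) fg0 => g fg0.
have [i fi fmin] := ex_minnP (ex_intro (fun n => f n != 0) n fn).
apply/funext => j; elim/ltn_ind: j => j g0.
move/(congr1 (@^~ (i + j)%N)): fg0; rewrite powserME.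
have lt_i : (i < (i + j).+1)%N by rewrite ltnS leq_addr.
rewrite (bigD1 (Ordinal lt_i)) //=.
rewrite addKn big1 ?addr0 => [/eqP|k /= ki].
  by rewrite mulf_eq0 (negPf fi) => /eqP.
(* Below [i] the factor from [f] vanishes by minimality; above [i] the factor from [g] has index
   less than [j]. *)
have := ki; rewrite -val_eqE /= neq_ltn => /orP[lt_ki|lt_ik].
  by have [->|/fmin] := eqVneq (f k) 0; rewrite ?mul0r // leqNgt lt_ki.
by rewrite g0 ?mulr0 // ltn_subLR ?ltn_add2r // -ltnS.
Qed.

(** Multiplied by [D1 * D2], both sides become [P * Q * N1 * N2]. *)
Lemma regular_exchange (A : comNzRingType) (D1 D2 N1 N2 P Q b1 b2 s1 s2 : A) :
  GRing.lreg D1 -> GRing.lreg D2 ->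
  D1 * b1 = P * N1 -> D2 * s2 = Q * N2 ->
  D2 * b2 = P * N2 -> D1 * s1 = Q * N1 -> b1 * s2 = b2 * s1.
Proof.
move=> reg1 reg2 Eb1 Es2 Eb2 Es1; apply: (lregM reg1 reg2).
by rewrite mulrACA Eb1 Es2 [b2 * s1]mulrC [RHS]mulrACA Eb2 Es1; ring.
Qed.

(** Cut into [w] blocks of length [d], the sum is the first block times a geometric sum in [v ^+ d];
    multiplying by [v ^+ d - 1] avoids a division. *)
Lemma big_periodicM (A : comNzRingType) (c : nat -> A) (d w : nat) (v : A) :
  (forall a, c (a + d)%N = c a) ->
  (v ^+ d - 1) * (\sum_(a < d * w) c a * v ^+ a) =
  (v ^+ (d * w) - 1) * (\sum_(a < d) c a * v ^+ a).
Proof.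
move=> c_per; have c_perM a k : c (d * k + a)%N = c a.
  by elim: k => [|k <-]; rewrite ?muln0 // mulnS -addnA addnC c_per.
elim: w => [|w IH]; first by rewrite muln0 big_ord0 subrr mul0r mulr0.
rewrite mulnS addnC big_split_ord /= mulrDr IH.
under [X in _ + _ * X]eq_bigr => a _ do rewrite c_perM exprD mulrCA.
by rewrite -big_distrr /= exprD; ring.
Qed.

(** * Exponential series in characteristic zero *)

Section Char0.

Variable K : fieldType.
Hypothesis K0 : [pchar K] =i pred0.

Let fact_neq0 n : n`!%:R != 0 :> K.
Proof. by move/pcharf0P: K0 => ->; rewrite -lt0n fact_gt0. Qed.

(** The series a e^(c t); constants are the case c = 0. *)
Definition powser_exp (a c : K) : powser K := fun n => a * (c ^+ n / n`!%:R).

Lemma powser_expM a b c e :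
  powser_exp a c * powser_exp b e = powser_exp (a * b) (c + e).
Proof.
apply/funext => n; rewrite powserME /powser_exp addrC exprDn big_distrl big_distrr /=.
apply: eq_bigr => i _; rewrite -mulr_natr.
have le_in : (i <= n)%N by rewrite -ltnS.
rewrite -(bin_fact le_in) !natrM.
have C0 : 'C(n, i)%:R != 0 :> K.
  by move/pcharf0P: K0 => ->; rewrite -lt0n bin_gt0.
by field; rewrite C0 !fact_neq0.
Qed.

Lemma powser_exp10 : powser_exp 1 0 = 1.
Proof.
apply/funext => n; rewrite powser1E /powser_exp mul1r expr0n.
by case: n => [|n]; rewrite ?divr1 ?mul0r.
Qed.

Lemma powser_expX a c n : powser_exp a c ^+ n = powser_exp (a ^+ n) (n%:R * c).
Proof.
elim: n => [|n IH]; first by rewrite !expr0 mul0r powser_exp10.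
by rewrite !exprS IH powser_expM -natr1 mulrDl mul1r addrC.
Qed.

Definition powser_t : powser K := fun n => (n == 1)%:R.

(** * Generating series of Bernoulli values and power sums *)

Section Twisted.

Variables (d : nat) (chi : int -> K) (xi : K).
Hypotheses (d_gt0 : (0 < d)%N) (xi_neq0 : xi != 0).
Hypothesis chi_per : forall a, chi (a + d%:Z) = chi a.

(* [xi e^t] *)
Let u := powser_exp xi 1.
Let chiS (a : nat) := powser_exp (chi a%:Z) 0.

Let uX n : u ^+ n = powser_exp (xi ^+ n) n%:R.
Proof. by rewrite powser_expX mulr1. Qed.

(* Both series carry the substitution t := w t; the first is divided by w. *)
Definition bernoulli_powser w x : powser K := fun n =>
  w%:R ^+ n / w%:R / n`!%:R * (bernoulli d chi n (xi ^+ w)).[x].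

Definition power_sum_powser w N : powser K := fun n =>
  w%:R ^+ n / n`!%:R * power_sum chi n N (xi ^+ w).

Definition twist w : powser K := u ^+ w.

(** For [N = d] this is the numerator N_w of the overview. *)
Definition twisted_sum N w : powser K := \sum_(a < N) chiS a * twist w ^+ a.

Let chiS_twistE w a n : (chiS a * twist w ^+ a) n =
  w%:R ^+ n / n`!%:R * (chi a%:Z * (xi ^+ w) ^+ a * a%:R ^+ n).
Proof.
rewrite /twist uX powser_expX powser_expM add0r /powser_exp exprMn.
by rewrite !mulrA [RHS]mulrC; field.
Qed.

Lemma power_sum_powserE w N : (0 < N)%N ->
  power_sum_powser w (N - 1) = twisted_sum N w.
Proof.
move=> N_gt0; apply/funext => n; rewrite /twisted_sum powser_sumE /power_sum_powser.
rewrite /power_sum subn1 prednK // big_distrr /=.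
by apply: eq_bigr => a _; rewrite chiS_twistE.
Qed.

(** The relation D_w s = Q N_w. The factor Q depends on [w] and [v] only through their product,
    which makes it symmetric later. *)
Lemma power_sum_powserM w v : (0 < v)%N ->
  (twist w ^+ d - 1) * power_sum_powser w (d * v - 1) =
  (twist (d * w * v) - 1) * twisted_sum d w.
Proof.
move=> v_gt0; rewrite power_sum_powserE ?muln_gt0 ?d_gt0 //.
rewrite /twisted_sum (big_periodicM (c := chiS)) => [|a]; last by rewrite /chiS PoszD chi_per.
by rewrite /twist -exprM mulnCA mulnA.
Qed.

(** The relation D_w b = P N_w, obtained from the defining generating function by evaluating the
    polynomial variable at [x] and substituting t := w t. *)
Lemma bernoulli_powserM w x : (0 < w)%N ->
  (twist w ^+ d - 1) * bernoulli_powser w x =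
  powser_t * powser_exp 1 (w%:R * x) * twisted_sum d w.
Proof.
move=> w_gt0.
have w0 : w%:R != 0 :> K by move/pcharf0P: K0 => ->; rewrite -lt0n.
(* Evaluation and substitution in one multiplicative map, so that each factor of the defining
   relation can be transported separately. *)
pose phi (F : nat -> {poly K}) : powser K := fun n => w%:R ^+ n * (F n).[x].
have phiM F G : phi (series_mul F G) = phi F * phi G.
  apply/funext => n; rewrite powserME /phi /series_mul horner_sum big_distrr.
  apply: eq_bigr => i _; rewrite hornerM mulrACA -exprD subnKC //.
  by rewrite -ltnS.
have phi_exp c : phi (series_exp c) = powser_exp 1 (w%:R * c.[x]).
  apply/funext => n; rewrite /phi /series_exp /powser_exp hornerZ horner_exp.
  by rewrite exprMn mul1r mulrCA mulrC.
have := bernoulli_spec chi K0 d_gt0 (expf_neq0 w xi_neq0).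
move/(congr1 phi); rewrite /bernoulli_num !phiM phi_exp hornerX.
have -> : phi (bernoulli_den d (xi ^+ w)) = twist w ^+ d - 1.
  apply/funext => n; rewrite powserBE powser1E /phi /bernoulli_den.
  rewrite /twist uX powser_expX /powser_exp /series_exp.
  rewrite hornerD hornerN !hornerZ horner_exp -!polyC_natr !hornerC exprMn.
  rewrite mulrBr; congr (_ - _); first by field.
  by case: n => [|n]; rewrite ?mulr1 ?mulr0.
have -> : phi (series_t {poly K}) = powser_exp w%:R 0 * powser_t.
  apply/funext => n; rewrite /phi /series_t powserME big_ord_recl big1 ?addr0 => [|i _].
    rewrite /powser_exp /powser_t subn0 expr0 divr1 mulr1 -polyC_natr hornerC.
    by case: n => [|[|n]]; rewrite ?mulr0 ?mulr1 ?expr1.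
  by rewrite /powser_exp /= exprS !mul0r mulr0 mul0r.
have -> : phi (fun n => \sum_(a < d) (chi a%:Z * (xi ^+ w) ^+ a)
    *: series_exp (a%:R : {poly K}) n) = twisted_sum d w.
  apply/funext => n; rewrite /twisted_sum powser_sumE /phi horner_sum big_distrr /=.
  apply: eq_bigr => a _; rewrite chiS_twistE !hornerZ horner_exp.
  by rewrite -polyC_natr hornerC; field.
set beta := phi _ => spec.
(* The division by [w] built into [bernoulli_powser] cancels the factor that t := w t produces from
   t. *)
have -> : bernoulli_powser w x = powser_exp w%:R^-1 0 * beta.
  apply/funext => n; rewrite powserME big_ord_recl big1 ?addr0 => [|i _].
    rewrite /beta /phi /powser_exp /bernoulli_powser subn0 expr0 divr1 mulr1.
    by move: (bernoulli _ _ _ _) => B; rewrite hornerZ; field; rewrite w0 fact_neq0.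
  by rewrite /powser_exp /= exprS !mul0r mulr0 mul0r.
rewrite mulrCA spec !mulrA powser_expM mulVf // addr0 powser_exp10.
by rewrite mul1r.
Qed.

(** The constant term vanishes when [xi ^+ (w * d) = 1], but the coefficient of t is [xi ^+ (w * d)]
    times [w * d], which is nonzero. *)
Lemma twist_lreg w : (0 < w)%N -> GRing.lreg (twist w ^+ d - 1).
Proof.
move=> w_gt0; apply: (@powser_lreg _ _ 1).
rewrite powserBE powser1E /twist -exprM uX /powser_exp subr0 expr1 divr1.
rewrite mulf_neq0 ?expf_neq0 //; move/pcharf0P: K0 => ->.
by rewrite -lt0n muln_gt0 w_gt0.
Qed.

(** * The triple product and its cyclic symmetry *)

Definition triple_powser w1 w2 w3 y : powser K :=
  bernoulli_powser (w2 * w3) (w1%:R * y)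
  * power_sum_powser (w1 * w3) (d * w2 - 1)
  * power_sum_powser (w1 * w2) (d * w3 - 1).

(** Both sides share the power sum series for [w1 * w2]. What remains exchanges the roles of
    [w2 * w3] and [w1 * w3] between a Bernoulli and a power sum series. *)
Lemma triple_powser_rot w1 w2 w3 y : (0 < w1)%N -> (0 < w2)%N -> (0 < w3)%N ->
  triple_powser w1 w2 w3 y = triple_powser w2 w3 w1 y.
Proof.
move=> w1_gt0 w2_gt0 w3_gt0; rewrite /triple_powser.
rewrite [(w3 * w1)%N]mulnC [(w2 * w1)%N]mulnC [RHS]mulrAC; congr (_ * _).
have w23_gt0 : (0 < w2 * w3)%N by rewrite muln_gt0 w2_gt0.
have w13_gt0 : (0 < w1 * w3)%N by rewrite muln_gt0 w1_gt0.
have bern1 := bernoulli_powserM (w1%:R * y) w23_gt0.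
have bern2 := bernoulli_powserM (w2%:R * y) w13_gt0.
have sum1 := power_sum_powserM (w2 * w3) w1_gt0.
have sum2 := power_sum_powserM (w1 * w3) w2_gt0.
(* These two identities make P and Q literally the same in all four relations. *)
have Ey : (w2 * w3)%:R * (w1%:R * y) = (w1 * w3)%:R * (w2%:R * y) :> K.
  by rewrite !natrM; ring.
have Ew : (d * (w1 * w3) * w2 = d * (w2 * w3) * w1)%N by ring.
rewrite Ey in bern1; rewrite Ew in sum2.
apply: regular_exchange bern1 sum2 bern2 sum1; exact: twist_lreg.
Qed.

(** The substitutions contribute [w2 * w3], [w1 * w3] and [w1 * w2] to the powers [k], [l] and [m];
    the exponents -1 come from dividing the Bernoulli series by [w2 * w3]. *)
Lemma triple_powserE w1 w2 w3 n y : (0 < w1)%N -> (0 < w2)%N -> (0 < w3)%N ->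
  n`!%:R * triple_powser w1 w2 w3 y n =
  \sum_(k < n.+1) \sum_(l < n.+1) \sum_(m < n.+1 | (k + l + m == n)%N)
    trinomial K n k l m
    * (bernoulli d chi k (xi ^+ (w2 * w3))).[w1%:R * y]
    * power_sum chi l (d * w2 - 1)%N (xi ^+ (w1 * w3))
    * power_sum chi m (d * w3 - 1)%N (xi ^+ (w1 * w2))
    * w1%:R ^ (l%:Z + m%:Z)
    * w2%:R ^ (k%:Z + m%:Z - 1)
    * w3%:R ^ (k%:Z + l%:Z - 1).
Proof.
have natr_neq0 v : (0 < v)%N -> v%:R != 0 :> K.
  by move/pcharf0P: K0 => -> v_gt0; rewrite -lt0n.
move=> /natr_neq0 w1_neq0 /natr_neq0 w2_neq0 /natr_neq0 w3_neq0.
rewrite /triple_powser powserM3E big_distrr /=; apply: eq_bigr => k _.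
rewrite big_distrr /=; apply: eq_bigr => l _.
rewrite big_distrr /=; apply: eq_bigr => m _.
rewrite /bernoulli_powser /power_sum_powser /trinomial !natrM !expfzDr //.
rewrite -!exprnP !exprN1 !exprMn.
by field; rewrite w2_neq0 w3_neq0 !fact_neq0.
Qed.

End Twisted.
End Char0.

(** * The identities over C_p *)

Theorem theorem4p4 (p : nat) (p_prime : prime p)
    (R : realType) (Cp : fieldType) (abs : Cp -> R)
    (Cp_padic : is_padic_complex abs p)
    (iota : {rmorphism algC -> Cp})
    (xi : Cp) (xi_ram : ramified_root p xi)
    (d : nat) (d_gt0 : (0 < d)%N)
    (chi0 : int -> algC) (chi_prim : is_primitive_dirichlet d chi0)
    (w1 w2 w3 : nat) (w1_gt0 : (0 < w1)%N) (w2_gt0 : (0 < w2)%N)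
    (w3_gt0 : (0 < w3)%N)
    (n : nat) (y1 : Cp) (y1_Zp : in_Zp abs y1) :
  let chi : int -> Cp := fun a => iota (chi0 a) in
  let B k eta := bernoulli d chi k eta in
  let S k N eta := power_sum chi k N eta in
  let E1 :=
    \sum_(k < n.+1) \sum_(l < n.+1) \sum_(m < n.+1 | (k + l + m == n)%N)
      trinomial Cp n k l m
      * (B k (xi ^+ (w2 * w3))).[w1%:R * y1]
      * S l (d * w2 - 1)%N (xi ^+ (w1 * w3))
      * S m (d * w3 - 1)%N (xi ^+ (w1 * w2))
      * w1%:R ^ (l%:Z + m%:Z)
      * w2%:R ^ (k%:Z + m%:Z - 1)
      * w3%:R ^ (k%:Z + l%:Z - 1) in
  let E2 :=
    \sum_(k < n.+1) \sum_(l < n.+1) \sum_(m < n.+1 | (k + l + m == n)%N)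
      trinomial Cp n k l m
      * (B k (xi ^+ (w1 * w3))).[w2%:R * y1]
      * S l (d * w3 - 1)%N (xi ^+ (w1 * w2))
      * S m (d * w1 - 1)%N (xi ^+ (w2 * w3))
      * w2%:R ^ (l%:Z + m%:Z)
      * w3%:R ^ (k%:Z + m%:Z - 1)
      * w1%:R ^ (k%:Z + l%:Z - 1) in
  let E3 :=
    \sum_(k < n.+1) \sum_(l < n.+1) \sum_(m < n.+1 | (k + l + m == n)%N)
      trinomial Cp n k l m
      * (B k (xi ^+ (w1 * w2))).[w3%:R * y1]
      * S l (d * w1 - 1)%N (xi ^+ (w2 * w3))
      * S m (d * w2 - 1)%N (xi ^+ (w1 * w3))
      * w3%:R ^ (l%:Z + m%:Z)
      * w1%:R ^ (k%:Z + m%:Z - 1)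
      * w2%:R ^ (k%:Z + l%:Z - 1) in
  E1 = E2 /\ E2 = E3.
Proof.
(* Characteristic zero is carried over from [algC] by the embedding [iota]. *)
have K0 : [pchar Cp] =i pred0.
  by move=> q; rewrite (fmorph_pchar iota) pchar_num.
have xi_neq0 : xi != 0.
  case: xi_ram => s _ xi_s; apply: contra_eq_neq xi_s => ->.
  by rewrite expr0n expn_eq0 -leqn0 leqNgt prime_gt0 // eq_sym oner_eq0.
have chi_per a : iota (chi0 (a + d%:Z)) = iota (chi0 a).
  by rewrite (dirichlet_periodic chi_prim.1).
move=> chi B S E1 E2 E3.
have EE v1 v2 v3 := @triple_powserE _ K0 d chi xi v1 v2 v3 n y1.
have rot v1 v2 v3 := triple_powser_rot K0 d_gt0 xi_neq0 chi_per y1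
  (w1 := v1) (w2 := v2) (w3 := v3).
have E1E : E1 = n`!%:R * triple_powser d chi xi w1 w2 w3 y1 n by rewrite EE.
have E2E : E2 = n`!%:R * triple_powser d chi xi w2 w3 w1 y1 n.
  by rewrite EE // [(w3 * w1)%N]mulnC [(w2 * w1)%N]mulnC.
have E3E : E3 = n`!%:R * triple_powser d chi xi w3 w1 w2 y1 n.
  by rewrite EE // [(w3 * w2)%N]mulnC [(w3 * w1)%N]mulnC.
by rewrite E1E E2E E3E (rot w1 w2 w3) // (rot w2 w3 w1).
Qed.
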